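(* There exists a real-closed ring, of cardinality $\aleph_1$, whose real spectrum is not homeomorphic to the $\ell$-spectrum of any Abelian $\ell$-group.
   Context: An $\ell$-group is a group with a translation-invariant lattice ordering. An $\ell$-ideal of an Abelian $\ell$-group $G$ is a subgroup that is also an order-convex sublattice. A prime $\ell$-ideal is a proper $\ell$-ideal $P$ such that $x\wedge y\in P$ implies $x\in P$ or $y\in P$. The $\ell$-spectrum of $G$ is the set of all prime $\ell$-ideals of $G$, with closed sets exactly the sets $\{P : I\subseteq P\}$ for $I\subseteq G$. For a commutative unital ring $R$, a cone is a subset that is both an additive and a multiplicative submonoid of $R$ and contains all squares. A cone $P$ is prime if $R=P\cup(-P)$ and $P\cap(-P)$ is a prime ideal of $R$. The real spectrum of $R$ is the set of all prime cones of $R$, with the topology generated by the sets $\{P : a\notin P\}$, $a\in R$. A lattice-ordered ring is a ring with a lattice ordering invariant under additive translations and preserved by multiplication by positive elements; it is an $f$-ring if for all $x,y,z\geq 0$, $x\wedge y=0$ implies $x\wedge yz=x\wedge zy=0$. A commutative unital ring $A$ is real-closed if: it has no nonzero nilpotent elements; the squares in $A$ form the positive cone of a structure of $f$-ring on $A$; $0\leq a\leq b$ implies $a^2\in Ab$; and for every prime ideal $P$ of $A$, the quotient field $A(P)$ of $A/P$ is a real closed field and $A/P$ is integrally closed in $A(P)$. *)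

(* Defs.v *)
From HB Require Import structures.
From mathcomp Require Import all_boot all_order all_algebra.
From mathcomp Require Import all_classical wochoice topology.

Set Implicit Arguments.
Unset Strict Implicit.
Unset Printing Implicit Defensive.

Import Order.TTheory GRing.Theory.

Local Open Scope classical_set_scope.
Local Open Scope ring_scope.

Section LatticeOrders.
Variables (T : Type) (le : T -> T -> Prop).

Definition is_meet (x y m : T) : Prop :=
  [/\ le m x, le m y & forall z, le z x -> le z y -> le z m].

Definition is_join (x y j : T) : Prop :=
  [/\ le x j, le y j & forall z, le x z -> le y z -> le j z].

Record lattice_order : Prop := {
  lo_refl : forall x, le x x;
  lo_anti : forall x y, le x y -> le y x -> x = y;
  lo_trans : forall y x z, le x y -> le y z -> le x z;
  lo_meet : forall x y, exists m, is_meet x y m;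
  lo_join : forall x y, exists j, is_join x y j
}.

End LatticeOrders.

Definition translation_invariant (V : zmodType) (le : V -> V -> Prop) : Prop :=
  forall z x y, le x y -> le (z + x) (z + y).

Record abLGroup := AbLGroup {
  lgroup_sort :> zmodType;
  lgroup_le : lgroup_sort -> lgroup_sort -> Prop;
  lgroup_lattice : lattice_order lgroup_le;
  lgroup_translation : translation_invariant lgroup_le
}.

Definition lideal (G : abLGroup) (I : set G) : Prop :=
  [/\ zmod_closed [in I],
      forall x y z, I x -> I y -> lgroup_le x z -> lgroup_le z y -> I z,
      forall x y m, I x -> I y -> is_meet (@lgroup_le G) x y m -> I m &
      forall x y j, I x -> I y -> is_join (@lgroup_le G) x y j -> I j].

Definition prime_lideal (G : abLGroup) (P : set G) : Prop :=
  [/\ lideal P, P <> setT &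
      forall x y m, is_meet (@lgroup_le G) x y m -> P m -> P x \/ P y].

Record lspec (G : abLGroup) := LSpec {
  lspec_set :> set G;
  lspec_prime : prime_lideal lspec_set
}.

HB.instance Definition _ (G : abLGroup) := gen_eqMixin (lspec G).
HB.instance Definition _ (G : abLGroup) := gen_choiceMixin (lspec G).

Section LSpecTopology.
Variable G : abLGroup.
Implicit Types (x y z : G) (P : lspec G).
Local Notation le := (@lgroup_le G).

Definition lspec_closed (C : set (lspec G)) : Prop :=
  exists I : set G, C = [set P : lspec G | I `<=` P].

Definition lspec_open (U : set (lspec G)) : Prop := lspec_closed (~` U).

Lemma lspec_openT : lspec_open setT.
Proof.
exists setT; rewrite setCT; apply/esym/seteqP; split=> // P /= sP.
by have [_ + _] := lspec_prime P; apply; apply/seteqP; split.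
Qed.

Lemma lspec_open_bigU (K : Type) (f : K -> set (lspec G)) :
  (forall i, lspec_open (f i)) -> lspec_open (\bigcup_i f i).
Proof.
move=> /choice[J fJ]; exists (\bigcup_i J i); rewrite setC_bigcup.
apply/seteqP; split=> P /=.
  by move=> fP x [i _ Jx]; have := fP i I; rewrite (fJ i); apply.
by move=> JP i _; rewrite (fJ i) => x Jx; apply: JP; exists i.
Qed.

Let pos x : G := projT1 (cid (lo_join (lgroup_lattice G) x 0)).
Let pabs x : G := pos x + pos (- x).
Let meet x y : G := projT1 (cid (lo_meet (lgroup_lattice G) x y)).

Let posP x : is_join le x 0 (pos x).
Proof. by rewrite /pos; case: cid. Qed.

Let meetP x y : is_meet le x y (meet x y).
Proof. by rewrite /meet; case: cid. Qed.

Let le_trans := lo_trans (lgroup_lattice G).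

Let le_addr x y : le 0 y -> le x (x + y).
Proof. by move=> /(lgroup_translation x); rewrite addr0. Qed.

Let pabs_ge0 x : le 0 (pabs x).
Proof.
have [[_ p0 _] [_ n0 _]] := (posP x, posP (- x)).
exact: le_trans p0 (le_addr _ n0).
Qed.

Let addpos x : x + pos (- x) = pos x.
Proof.
have [[px p0 pm] [nx n0 nm]] := (posP x, posP (- x)).
apply: (lo_anti (lgroup_lattice G)).
  rewrite -[X in le _ X](addNKr x); apply: lgroup_translation.
  apply: nm; first exact: le_addr.
  by have := lgroup_translation (- x) px; rewrite addNr.
apply: pm; first exact: le_addr.
by have := lgroup_translation x nx; rewrite addrN.
Qed.

Let lspec_pabs P x : lspec_set P (pabs x) <-> lspec_set P x.
Proof.
case: P => P /= [[[/set_mem P0 PB] convP _ joinP] _ _].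
have subP u v : P u -> P v -> P (u - v).
  by move=> Pu Pv; apply/set_mem/PB; apply/mem_set.
have oppP u : P u -> P (- u) by move=> Pu; rewrite -sub0r; apply: subP.
have [[_ p0 _] [_ n0 _]] := (posP x, posP (- x)).
split=> [Pa|Px].
  have -> : x = pos x - pos (- x) by rewrite -addpos addrK.
  apply: subP; first exact: convP P0 Pa p0 (le_addr _ n0).
  by apply: convP P0 Pa n0 _; rewrite /pabs addrC; exact: le_addr.
rewrite /pabs -[pos (- x)]opprK; apply: subP.
  exact: joinP Px P0 (posP x).
exact: oppP (joinP _ _ _ (oppP _ Px) P0 (posP (- x))).
Qed.

Lemma lspec_openI : setI_closed lspec_open.
Proof.
move=> U V [I UI] [J VJ].
exists [set meet (pabs x) (pabs y) | x in I & y in J].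
rewrite setCI UI VJ; apply/seteqP; split=> P /=.
  have [[[/set_mem P0 _] convP _ _] _ _] := lspec_prime P.
  move=> sP _ [x Ix] [y Jy] <-.
  have [mx my mm] := meetP (pabs x) (pabs y).
  have m0 := mm _ (pabs_ge0 x) (pabs_ge0 y).
  case: sP => sP.
    by apply: convP P0 _ m0 mx; apply/lspec_pabs; apply: sP.
  by apply: convP P0 _ m0 my; apply/lspec_pabs; apply: sP.
move=> sP; apply: contrapT => /not_orP[/existsNP[x /not_implyP[Ix nPx]]].
move=> /existsNP[y /not_implyP[Jy nPy]].
have [_ _ prP] := lspec_prime P.
have /(prP _ _ _ (meetP _ _))[] : lspec_set P (meet (pabs x) (pabs y)).
- by apply: sP; exists x => //; exists y.
- by move/lspec_pabs.
- by move/lspec_pabs.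
Qed.

HB.instance Definition _ := isOpenTopological.Build (lspec G)
  lspec_openT lspec_openI lspec_open_bigU.

Lemma closed_lspecP (C : set (lspec G)) : closed C <-> lspec_closed C.
Proof. by rewrite -openC -[X in lspec_closed X]setCK. Qed.

End LSpecTopology.

Section RealSpectrum.
Variable R : comNzRingType.

Definition is_prime_ideal (I : set R) : Prop :=
  idealr_closed [in I] /\ prime_idealr_closed [in I].

Definition cone (P : set R) : Prop :=
  GRing.semiring_closed [in P] /\ forall x, P (x ^+ 2).

Definition prime_cone (P : set R) : Prop :=
  [/\ cone P, (forall x, P x \/ P (- x)) &
      is_prime_ideal [set x | P x /\ P (- x)]].

Record rspec := RSpec {
  rspec_set :> set R;
  rspec_prime : prime_cone rspec_set
}.

HB.instance Definition _ := gen_eqMixin rspec.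
HB.instance Definition _ := gen_choiceMixin rspec.

(* The subbase is indexed by itself: the factory wants a pointed index type. *)
HB.instance Definition _ := isSubBaseTopological.Build rspec
  [set [set P : rspec | ~ rspec_set P a] | a in [set: R]] id.

End RealSpectrum.

Definition homeomorphic (X Y : topologicalType) : Prop :=
  exists (f : X -> Y) (g : Y -> X),
    [/\ continuous f, continuous g, cancel f g & cancel g f].

Record lattice_ordered_ring (R : nzRingType) (le : R -> R -> Prop) : Prop := {
  lor_lattice : lattice_order le;
  lor_translation : translation_invariant le;
  lor_mul : forall z x y, le 0 z -> le x y ->
    le (z * x) (z * y) /\ le (x * z) (y * z)
}.

Definition f_ring (R : nzRingType) (le : R -> R -> Prop) : Prop :=
  lattice_ordered_ring le /\
  forall x y z, le 0 x -> le 0 y -> le 0 z -> is_meet le x y 0 ->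
    is_meet le x (y * z) 0 /\ is_meet le x (z * y) 0.

Section ResidueDomain.
Variables (R : comNzRingType) (P : prime_idealr R).

Definition residue : Type := {ideal_quot P}.

HB.instance Definition _ := GRing.ComNzRing.on residue.

Definition residue_unit (x : residue) : bool := `[< exists y, y * x = 1 >].

Definition residue_inv (x : residue) : residue :=
  if pselect (exists y, y * x = 1) is left e then projT1 (cid e) else x.

Lemma residue_mulVx : {in residue_unit, left_inverse 1 residue_inv *%R}.
Proof.
move=> x /asboolP ux; rewrite /residue_inv.
by case: pselect => // e; case: cid.
Qed.

Lemma residue_unitPl (x y : residue) : y * x = 1 -> residue_unit x.
Proof. by move=> yx; apply/asboolP; exists y. Qed.

Lemma residue_inv_out : {in [predC residue_unit], residue_inv =1 id}.
Proof.
move=> x /negP ux; rewrite /residue_inv.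
by case: pselect => // e; case: ux; apply/asboolP.
Qed.

HB.instance Definition _ := GRing.ComNzRing_hasMulInverse.Build residue
  residue_mulVx residue_unitPl residue_inv_out.

HB.instance Definition _ := GRing.ComUnitRing_isIntegral.Build residue
  (@Quotient.rquot_IdomainAxiom R P).

Definition residue_field : fieldType := {fraction residue}.

Definition to_residue_field : residue -> residue_field := @tofrac residue.

End ResidueDomain.

(* [rcfType] carries an order; a bare field is real closed when it is isomorphic
   to the underlying field of some [rcfType]. *)
Definition real_closed_field (F : fieldType) : Prop :=
  exists (K : rcfType) (f : {rmorphism F -> K}), bijective f.

Definition integrally_closed (D K : nzRingType) (f : D -> K) : Prop :=
  forall z : K, integralOver f z -> exists d : D, z = f d.

Definition real_closed_ring (A : comNzRingType) : Prop :=
  [/\ forall (x : A) (n : nat), x ^+ n = 0 -> x = 0,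
      exists le : A -> A -> Prop,
        [/\ f_ring le,
            forall x, le 0 x <-> exists y, x = y ^+ 2 &
            forall a b, le 0 a -> le a b -> exists c, a ^+ 2 = c * b] &
      forall P : prime_idealr A,
        real_closed_field (residue_field P) /\
        integrally_closed (@to_residue_field A P)].

(* [T] is equipotent with the first uncountable ordinal: it carries a
   (reflexive) well-order that is uncountable while all its initial segments
   are countable. *)
Definition has_card_aleph1 (T : Type) : Prop :=
  exists le : rel T,
    [/\ well_order le,
        ~ countable [set: T] &
        forall x, countable [set y | le y x]].

(* Main.v *)
Require Import Defs.
From HB Require Import structures.
From mathcomp Require Import all_boot all_order all_algebra.
From mathcomp Require Import all_classical wochoice topology.
From mathcomp Require Import algC ring lra.

(** Let [K] be a countable real closed field with an infinitesimal [t > 0], let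
    [W] be a pointed set of cardinality aleph_1, and let [A] be the ring of
    those functions [f : W -> K] that are constant outside a finite set, with
    limit value [f point] bounded by an integer.  Roots of polynomials with
    coefficients in [A] can be chosen pointwise between prescribed bounds
    without leaving [A]; this intermediate value property alone makes [A] a
    real-closed ring.  The same argument, for a countable ring of sequences of
    real algebraic numbers closed under choice of roots, modulo a nonprincipal
    ultrafilter, yields [K].

    In the real spectrum of [A], the closed points [{f | 0 <= f w}], for
    [w <> point], converge to [q = {f | 0 <= f point}], which specialises
    properly to [p = {f | 0 <= f point or f point is infinitesimal}].  In an
    l-spectrum, pick [y >= 0] in [p] but not in [q], and [u >= 0] not in [p].
    Each open set [{P | (u - n y)^+ notin P}] contains [p], hence all but
    finitely many [w]; as [W] is uncountable, some [w] belongs to all of them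
    and to [{P | y notin P}].  If [P] is the prime l-ideal attached to such a
    [w], then the set of all [g] with [|g| <= n y + z] for some [n] and some
    [z] in [P] is a prime l-ideal that contains [P] properly, so that [P] is
    not closed. *)

Set Implicit Arguments.
Unset Strict Implicit.
Unset Printing Implicit Defensive.

Import Order.TTheory GRing.Theory Num.Theory.

Local Open Scope classical_set_scope.
Local Open Scope ring_scope.

(** * Rings of functions with the intermediate value property *)

(** One [c] serves all points: a root wherever the sign condition holds, merely within the bounds
    elsewhere. Operations that make sense on a part of [W] are thus realised in [A]. *)
Record ivt_function_ring (A : comNzRingType) (W : Type) (K : rcfType)
    (ev : W -> {rmorphism A -> K}) : Prop := {
  ivt_inj : forall a b, (forall w, ev w a = ev w b) -> a = b;
  ivt_root : forall (p : {poly A}) a b, (forall w, ev w a <= ev w b) ->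
    exists c, forall w, ev w a <= ev w c <= ev w b /\
      (ev w p.[a] <= 0 <= ev w p.[b] -> ev w p.[c] = 0)
}.

Section IvtFunctionRing.
Variables (A : comNzRingType) (W : Type) (K : rcfType).
Variable ev : W -> {rmorphism A -> K}.
Hypothesis ivtA : ivt_function_ring ev.
Implicit Types a b c d : A.

Definition pw_le a b : Prop := forall w, ev w a <= ev w b.

Lemma pw_le_anti a b : pw_le a b -> pw_le b a -> a = b.
Proof.
move=> ab ba; apply: (ivt_inj ivtA) => w.
by apply/eqP; rewrite eq_le ab ba.
Qed.

Lemma pw_sqrt a :
  exists2 c, pw_le 0 c & forall w, 0 <= ev w a -> ev w c ^+ 2 = ev w a.
Proof.
(* ['X^2 - a%:P] is nonnegative at [a ^+ 2 + 1] for either sign of [a], so a sign change occurs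
   exactly where [a >= 0]. *)
have [w|c cP] := @ivt_root _ _ _ _ ivtA ('X^2 - a%:P) 0 (a ^+ 2 + 1).
  by rewrite rmorph0 rmorphD rmorphXn rmorph1; nra.
exists c => w; first by have [/andP[]] := cP w.
move=> a0; have [_] := cP w.
rewrite !(hornerD, hornerN, hornerXn, hornerC) !rmorphB !rmorphXn /=.
rewrite !rmorphD rmorph1 rmorph0 !rmorphXn => /(_ _)/eqP.
rewrite subr_eq0 => /(_ _)/eqP; apply; apply/andP; split; first by nra.
by set x := ev w a; have := sqr_ge0 (x ^+ 2); have := sqr_ge0 (x - 1); nra.
Qed.

Lemma pw_div a b :
  exists c, forall w, `|ev w a| <= `|ev w b| -> ev w c * ev w b = ev w a.
Proof.
(* The extra factor [b] in [b * (b * 'X - a)] makes the sign change between -1 and 1 independent of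
   the sign of [b]. *)
have [w|c cP] := @ivt_root _ _ _ _ ivtA (b ^+ 2 *: 'X - (a * b)%:P) (- 1) 1.
  by rewrite rmorphN rmorph1; lra.
exists c => w ab; have [_] := cP w.
rewrite !(hornerD, hornerN, hornerZ, hornerX, hornerC).
rewrite !(rmorphB, rmorphXn, rmorphM, rmorphN, rmorph1) /= !expr2.
have [b0|b0] := eqVneq (ev w b) 0.
  by move: ab; rewrite b0 normr0 normr_le0 => /eqP-> _; rewrite mulr0.
move=> /(_ _)/eqP; rewrite subr_eq0 => /(_ _)/eqP h.
apply: (mulIf b0); rewrite -mulrA mulrC h //.
have : `|ev w a * ev w b| <= ev w b * ev w b.
  by rewrite normrM -expr2 -real_normK ?num_real// expr2 ler_wpM2r.
by rewrite ler_norml => /andP[]; lra.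
Qed.

Lemma pw_sqrE a : pw_le 0 a <-> exists b, a = b ^+ 2.
Proof.
split=> [a0|[b ->] w]; last by rewrite rmorph0 rmorphXn sqr_ge0.
have [c _ cP] := pw_sqrt a; exists c; apply: (ivt_inj ivtA) => w.
by rewrite rmorphXn cP // -(rmorph0 (ev w)).
Qed.

Lemma ivt_half : exists h : A, forall w, ev w h = 2^-1.
Proof.
have [h hP] := pw_div 1 2%:R; exists h => w; have := hP w.
rewrite rmorph1 rmorph_nat normr1 normr_nat ler1n => /(_ isT) h2.
by apply: (@mulIf _ 2%:R); rewrite ?pnatr_eq0// h2 mulVf ?pnatr_eq0.
Qed.

(** The maximum is half of [a + b + |a - b|], with |a - b| obtained as the nonnegative square root
    of [(a - b) ^+ 2]. *)
Lemma pw_max a b : exists c, forall w, ev w c = Num.max (ev w a) (ev w b).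
Proof.
have [h hP] := ivt_half; have [c c0 cP] := pw_sqrt ((a - b) ^+ 2).
exists (h * (a + b + c)) => w; have := cP w; have := c0 w.
rewrite rmorph0 rmorphXn rmorphM !rmorphD rmorphN hP sqr_ge0 => ? /(_ isT).
move=> /eqP; rewrite eqf_sqr.
by case/orP=> /eqP ec; rewrite ec in c0 *; case: leP; lra.
Qed.

Lemma pw_min a b : exists c, forall w, ev w c = Num.min (ev w a) (ev w b).
Proof.
have [c cP] := pw_max (- a) (- b); exists (- c) => w.
by rewrite rmorphN cP !rmorphN -oppr_min opprK.
Qed.

Lemma pw_lattice : lattice_order pw_le.
Proof.
split=> [a w //|||a b|a b].
- exact: pw_le_anti.
- by move=> b a c ab bc w; apply: le_trans (bc w).
- have [m mP] := pw_min a b; exists m; split=> [w|w|z za zb w].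
  + by rewrite mP ge_min lexx.
  + by rewrite mP ge_min lexx orbT.
  + by rewrite mP le_min za zb.
- have [m mP] := pw_max a b; exists m; split=> [w|w|z za zb w].
  + by rewrite mP le_max lexx.
  + by rewrite mP le_max lexx orbT.
  + by rewrite mP ge_max za zb.
Qed.

Lemma pw_meet0 a b w :
  is_meet pw_le a b 0 -> ev w a = 0 \/ ev w b = 0.
Proof.
have [m mP] := pw_min a b; move=> [a0 b0 /(_ m)] mz.
have /(_ w) : pw_le m 0.
  by apply: mz => v; rewrite mP ge_min lexx ?orbT.
have := a0 w; have := b0 w; rewrite rmorph0 mP.
by case: (leP (ev w a) (ev w b)) => _ b0w a0w m0w; [left|right]; apply/eqP;
  rewrite eq_le m0w ?a0w ?b0w.
Qed.

Lemma pw_f_ring : f_ring pw_le.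
Proof.
split; first split=> [||z x y z0 xy].
- exact: pw_lattice.
- by move=> z x y xy w; rewrite !rmorphD lerD2l.
- split=> w; rewrite !rmorphM; have := z0 w; rewrite rmorph0 => z0w.
    exact: ler_wpM2l.
  exact: ler_wpM2r.
move=> x y z x0 y0 z0 xy.
have yz0 : pw_le 0 (y * z).
  move=> w; rewrite rmorphM rmorph0; apply: mulr_ge0.
    by have := y0 w; rewrite rmorph0.
  by have := z0 w; rewrite rmorph0.
suff : is_meet pw_le x (y * z) 0 by rewrite [z * y]mulrC; split.
split=> // u ux uyz w; have [x0w|y0w] := pw_meet0 w xy.
  by have := ux w; rewrite x0w rmorph0.
by have := uyz w; rewrite rmorphM y0w mul0r rmorph0.
Qed.

Lemma pw_dvd a b : pw_le 0 a -> pw_le a b -> exists c, a = c * b.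
Proof.
move=> a0 ab; have [c cP] := pw_div a b; exists c.
apply: (ivt_inj ivtA) => w; rewrite rmorphM cP //.
have := a0 w; rewrite rmorph0 => a0w.
by rewrite !ger0_norm // (le_trans a0w).
Qed.

Lemma ivt_reduced a n : a ^+ n = 0 -> a = 0.
Proof.
move=> an0; apply: (ivt_inj ivtA) => w; rewrite rmorph0.
have /eqP : ev w a ^+ n = 0 by rewrite -rmorphXn an0 rmorph0.
by rewrite expf_eq0 => /andP[_ /eqP].
Qed.

End IvtFunctionRing.

(** * Criteria for real closed fields and integrally closed domains *)

Definition is_square (R : pzRingType) (x : R) : Prop := exists y, x = y ^+ 2.

(** The order is recovered from the field: [x <= y] when [y - x] is a square. The intermediate value
    property is stated between 0 and 1; an affine substitution carries any other interval there. *)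
Lemma real_closed_field_of_squares (F : fieldType) :
  (forall x y : F, is_square x -> is_square y -> is_square (x + y)) ->
  (forall x : F, is_square x \/ is_square (- x)) ->
  (forall x : F, is_square x -> is_square (- x) -> x = 0) ->
  (forall p : {poly F}, is_square (- p.[0]) -> is_square p.[1] ->
    exists c, [/\ is_square c, is_square (1 - c) & root p c]) ->
  real_closed_field F.
Proof.
move=> sqD sq_total sq_anti sq_ivt.
pose le (x y : F) := `[< is_square (y - x) >].
pose lt (x y : F) := (y != x) && le x y.
pose norm (x : F) := if le 0 x then x else - x.
have le0 x : le 0 x = `[< is_square x >] by rewrite /le subr0.
have leN x : le x 0 = `[< is_square (- x) >] by rewrite /le sub0r.
have sqM (x y : F) : is_square x -> is_square y -> is_square (x * y).
  by move=> [u ->] [v ->]; exists (u * v); rewrite exprMn.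
have le0D x y : le 0 x -> le 0 y -> le 0 (x + y).
  by rewrite !le0 => /asboolP sx /asboolP sy; apply/asboolP; apply: sqD.
have le0M x y : le 0 x -> le 0 y -> le 0 (x * y).
  by rewrite !le0 => /asboolP sx /asboolP sy; apply/asboolP; apply: sqM.
have le0A x : le 0 x -> le x 0 -> x = 0.
  by rewrite le0 leN => /asboolP sx /asboolP; apply: sq_anti.
have subge x y : le 0 (y - x) = le x y by rewrite le0.
have letot x : le 0 x || le x 0.
  rewrite le0 leN; apply/orP.
  by case: (sq_total x) => ?; [left|right]; apply/asboolP.
have normN x : norm (- x) = norm x.
  rewrite /norm !le0.
  case: asboolP => sNx; case: asboolP => sx; rewrite ?opprK //.
    by rewrite (sq_anti _ sx sNx) oppr0.
  by case: (sq_total x).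
have ge0n x : le 0 x -> norm x = x by rewrite /norm => ->.
pose mix := Num.IntegralDomain_isLeReal.Build F le0D le0M le0A subge letot
  normN ge0n (fun x y => erefl (lt x y)).
pose RF : realFieldType := HB.pack F mix.
have ivt : Num.real_closed_axiom RF.
  move=> p a b ab /andP[pa pb].
  have leE (x y : RF) : (x <= y) = `[< is_square ((y - x) : F) >] by [].
  have qE t : (p \Po (a%:P + (b - a) *: 'X)).[t] = p.[a + (b - a) * t].
    by rewrite horner_comp !(hornerD, hornerC, hornerZ, hornerX).
  have [||c] := sq_ivt (p \Po (a%:P + (b - a) *: 'X)).
  - rewrite qE mulr0 addr0.
    by move: pa; rewrite leE sub0r => /asboolP.
  - rewrite qE mulr1 subrKC.
    by move: pb; rewrite leE subr0 => /asboolP.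
  move=> [sc s1c]; rewrite /root qE => rc.
  have sab : is_square ((b - a) : F) by move: ab; rewrite leE => /asboolP.
  exists (a + (b - a) * c); last by rewrite /root.
  rewrite !leE; apply/andP; split; apply/asboolP.
    by rewrite addrC addKr; apply: sqM.
  have -> : b - (a + (b - a) * c) = (b - a) * (1 - c) by ring.
  exact: sqM.
pose RC : rcfType := HB.pack RF (Num.RealField_isClosed.Build RF ivt).
by exists RC, (idfun : {rmorphism F -> RC}); exists id.
Qed.

(* If [1/x = c] lies in the valuation ring, dividing an integral equation of
   degree [n] for [x] by [x^(n-1)] exhibits [x] as a polynomial in [c]. *)
Lemma valuation_integrally_closed (D : comNzRingType) (F : fieldType)
    (psi : {rmorphism D -> F}) :
  (forall x : F, exists a b, psi b != 0 /\ x = psi a / psi b) ->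
  (forall a b, (exists c, psi a = psi c * psi b) \/
               (exists c, psi b = psi c * psi a)) ->
  integrally_closed psi.
Proof.
move=> fracF val x; have [a [b [b0 ->]]] := fracF x.
move=> [p pm]; rewrite rootE.
have [[c ->]|[c bE]] := val a b.
  by exists c; rewrite mulfK.
have c0 : psi c != 0 by apply: contraNneq b0 => c0; rewrite bE c0 mul0r.
have a0 : psi a != 0 by apply: contraNneq b0 => a0; rewrite bE a0 mulr0.
have -> : psi a / psi b = (psi c)^-1 by rewrite bE; field; rewrite a0 c0.
have [n pn] : exists n, size p = n.+1.
  by exists (size p).-1; rewrite prednK// size_poly_gt0 monic_neq0.
have pS : size (map_poly psi p) = n.+1.
  by rewrite size_map_poly_id0 // (monicP pm) rmorph1 oner_neq0.
have pn1 : (map_poly psi p)`_n = 1.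
  have /monicP := pm; rewrite coef_map lead_coefE pn => ->.
  exact: rmorph1.
rewrite horner_coef pS big_ord_recr /= pn1 mul1r => /eqP.
move=> /(congr1 (fun y => y * psi c ^+ n)); rewrite mul0r mulrDl exprVn.
rewrite mulVf ?expf_neq0// => /eqP; rewrite addrC addr_eq0 => /eqP eS.
case: n pn pS pn1 eS => [|n] pn pS pn1 eS.
  by move: eS; rewrite big_ord0 mul0r oppr0 => /eqP; rewrite oner_eq0.
exists (- \sum_(i < n.+1) p`_i * c ^+ (n - i)).
apply: (mulIf c0); rewrite mulVf // eS rmorphN mulNr; congr (- _).
rewrite rmorph_sum /= !mulr_suml; apply: eq_bigr => i _.
rewrite coef_map rmorphM rmorphXn /= -!mulrA; congr (_ * _).
have in1 : (i <= n)%N by rewrite -ltnS.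
rewrite -exprSr -subSn// exprVn.
have -> : psi c ^+ n.+1 = psi c ^+ i * psi c ^+ (n.+1 - i).
  by rewrite -exprD subnKC // leqW.
by rewrite mulrA mulVf ?mul1r// expf_neq0.
Qed.

Section Fractions.
Variables (A : comNzRingType) (W : Type) (K : rcfType).
Variable ev : W -> {rmorphism A -> K}.
Hypothesis ivtA : ivt_function_ring ev.
Variables (F : fieldType) (psi : {rmorphism A -> F}).

(** The two quotients given by [pw_div] are valid on sets that cover [W], so a product of two
    differences is 0 in [A]. As [F] is a field, [psi] kills one factor: a pointwise alternative
    becomes a global one. *)
Lemma frac_valuation a b :
  (exists c, psi a = psi c * psi b) \/ (exists c, psi b = psi c * psi a).
Proof.
have [c cP] := pw_div ivtA a b; have [d dP] := pw_div ivtA b a.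
have /eqP : psi ((a - c * b) * (b - d * a)) = 0.
  rewrite -(rmorph0 psi); congr (psi _); apply: (ivt_inj ivtA) => w.
  rewrite rmorph0 !(rmorphM, rmorphN, rmorphD) /=.
  have [/cP->|/ltW/dP->] := leP `|ev w a| `|ev w b|.
    by rewrite subrr mul0r.
  by rewrite subrr mulr0.
rewrite rmorphM mulf_eq0 !rmorphB !rmorphM !subr_eq0.
by case/orP=> /eqP ?; [left; exists c|right; exists d].
Qed.

Lemma psi_square_total a : is_square (psi a) \/ is_square (- psi a).
Proof.
have [c _ cP] := pw_sqrt ivtA a; have [d _ dP] := pw_sqrt ivtA (- a).
have /eqP : psi ((a - c ^+ 2) * (a + d ^+ 2)) = 0.
  rewrite -(rmorph0 psi); congr (psi _); apply: (ivt_inj ivtA) => w.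
  rewrite rmorph0 !(rmorphXn, rmorphM, rmorphN, rmorphD) /=.
  have [/cP->|a0] := leP 0 (ev w a); first by rewrite subrr mul0r.
  by rewrite dP rmorphN ?oppr_ge0 ?(ltW a0)// subrr mulr0.
rewrite rmorphM mulf_eq0 rmorphB rmorphD !rmorphXn subr_eq0 addr_eq0.
case/orP=> /eqP ->; first by left; exists (psi c).
by rewrite opprK; right; exists (psi d).
Qed.

Lemma psi_sqrD a b : exists c, psi a ^+ 2 + psi b ^+ 2 = psi c ^+ 2.
Proof.
have /(pw_sqrE ivtA)[c cP] : pw_le ev 0 (a ^+ 2 + b ^+ 2).
  by move=> w; rewrite rmorph0 rmorphD !rmorphXn addr_ge0 ?sqr_ge0.
by exists c; rewrite -!rmorphXn -rmorphD cP.
Qed.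

(** Formal reality: [a ^+ 2] lies between 0 and [a ^+ 2 + b ^+ 2], hence is a multiple of the latter
    already in [A]. *)
Lemma psi_sqrD_eq0 a b : psi a ^+ 2 + psi b ^+ 2 = 0 -> psi a = 0.
Proof.
move=> ab0.
have [||c /(congr1 psi)] := @pw_dvd _ _ _ _ ivtA (a ^+ 2) (a ^+ 2 + b ^+ 2).
- by move=> w; rewrite rmorph0 rmorphXn sqr_ge0.
- by move=> w; rewrite rmorphD !rmorphXn lerDl sqr_ge0.
rewrite rmorphM rmorphD !rmorphXn ab0 mulr0 => /eqP.
by rewrite expf_eq0 => /andP[_ /eqP].
Qed.

Hypothesis fracF : forall x : F, exists a b, psi b != 0 /\ x = psi a / psi b.

(** The denominator is squared so that clearing it preserves the signs of the values of [p], signs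
    in [F] being read off from squares. *)
Lemma poly_common_denominator (p : {poly F}) :
  exists q d, psi d != 0 /\ map_poly psi q = psi d ^+ 2 *: p.
Proof.
elim/poly_ind: p => [|p x [q [d [d0 qE]]]].
  by exists 0, 1; rewrite rmorph1 oner_eq0 rmorph0 scaler0.
have [a [b [b0 ->]]] := fracF x.
exists ((b ^+ 2)%:P * q * 'X + (a * b * d ^+ 2)%:P), (b * d).
rewrite rmorphM mulf_neq0 //; split=> //.
rewrite rmorphD !rmorphM /= !map_polyC /= map_polyX qE.
rewrite scalerDr; congr (_ + _).
  by rewrite -!mul_polyC !expr2 !polyCM; ring.
by rewrite -mul_polyC -!polyCM; congr (_%:P); field.
Qed.

Lemma real_closed_field_of_fractions : real_closed_field F.
Proof.
have sqD (x y : F) : is_square x -> is_square y -> is_square (x + y).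
  move=> [u ->] [v ->]; have [a [b [b0 ->]]] := fracF u.
  have [c [d [d0 ->]]] := fracF v.
  have [e eE] := psi_sqrD (a * d) (c * b).
  exists (psi e / psi (b * d)); rewrite !exprMn exprVn -eE !rmorphM; field.
  by rewrite b0 d0.
have sq_anti0 (x y : F) : x ^+ 2 + y ^+ 2 = 0 -> x = 0.
  have [a [b [b0 ->]]] := fracF x; have [c [d [d0 ->]]] := fracF y => h.
  have : psi (a * d) = 0.
    apply: (@psi_sqrD_eq0 _ (c * b)); rewrite !rmorphM.
    transitivity (((psi a / psi b) ^+ 2 + (psi c / psi d) ^+ 2) *
      (psi b * psi d) ^+ 2); last by rewrite h mul0r.
    by field; rewrite b0 d0.
  move=> /eqP; rewrite rmorphM mulf_eq0 (negPf d0) orbF => /eqP ->.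
  by rewrite mul0r.
have sq_anti (x : F) : is_square x -> is_square (- x) -> x = 0.
  move=> [u ->] [v vE]; rewrite (sq_anti0 u v) ?expr0n//.
  by rewrite -vE subrr.
have sqM (x y : F) : is_square x -> is_square y -> is_square (x * y).
  by move=> [u ->] [v ->]; exists (u * v); rewrite exprMn.
have sqV (x y : F) : y != 0 -> is_square (y ^+ 2 * x) -> is_square x.
  move=> y0 [u uE]; exists (u / y); rewrite exprMn -uE exprVn mulrAC.
  by rewrite divff ?mul1r// sqrf_eq0.
have sq_psi a : pw_le ev 0 a -> is_square (psi a).
  by move=> /(pw_sqrE ivtA)[b ->]; exists (psi b); rewrite rmorphXn.
apply: real_closed_field_of_squares => // [x|p].
  have [a [b [b0 ->]]] := fracF x.
  have [s|s] := psi_square_total (a * b); [left|right].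
    apply: (sqV _ _ b0); rewrite rmorphM in s.
    by have -> : psi b ^+ 2 * (psi a / psi b) = psi a * psi b by field.
  apply: (sqV _ _ b0); rewrite rmorphM in s.
  by have -> : psi b ^+ 2 * (- (psi a / psi b)) = - (psi a * psi b) by field.
have [q [d [d0 qE]]] := poly_common_denominator p.
have hE x : psi q.[x] = psi d ^+ 2 * p.[psi x].
  by rewrite -horner_map qE hornerZ.
have rootP x : psi q.[x] = 0 -> root p (psi x).
  by move/eqP; rewrite hE mulf_eq0 sqrf_eq0 (negPf d0).
move=> p0 p1.
have q0 : is_square (- psi q.[0]).
  by rewrite hE rmorph0 -mulrN; apply: sqM p0; exists (psi d).
have q1 : is_square (psi q.[1]).
  by rewrite hE rmorph1; apply: sqM p1; exists (psi d).
(* Roots at the endpoints are settled first, so that below the values at 0 and 1 have strict signs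
   in [F]. *)
have [q00|q00] := eqVneq (psi q.[0]) 0.
  exists 0; split; first by exists 0; rewrite expr0n.
    by exists 1; rewrite subr0 expr1n.
  by rewrite -(rmorph0 psi); apply: rootP.
have [q10|q10] := eqVneq (psi q.[1]) 0.
  exists 1; split; first by exists 1; rewrite expr1n.
    by exists 0; rewrite subrr expr0n.
  by rewrite -(rmorph1 psi); apply: rootP.
have [w|c cP] := @ivt_root _ _ _ _ ivtA q 0 1.
  by rewrite rmorph0 rmorph1 ler01.
exists (psi c); split.
- by apply: sq_psi => w; have [/andP[]] := cP w.
- rewrite -(rmorph1 psi) -rmorphB; apply: sq_psi => w.
  by rewrite rmorph0 rmorphB subr_ge0; have [/andP[]] := cP w.
apply: rootP.
have [g _ gP] := pw_sqrt ivtA q.[0]; have [h _ hP] := pw_sqrt ivtA (- q.[1]).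
(* At each point [q.[0] >= 0], or [q.[1] <= 0], or [c] is a root of [q], so the product of the three
   matching factors is 0. If [psi] killed the second or third factor, a strict sign at an endpoint
   would be contradicted. *)
have /eqP : psi (q.[c] * ((q.[0] - g ^+ 2) * (q.[1] + h ^+ 2))) = 0.
  rewrite -(rmorph0 psi); congr (psi _); apply: (ivt_inj ivtA) => w.
  rewrite rmorph0 !(rmorphXn, rmorphM, rmorphN, rmorphD) /=.
  have [/gP->|/ltW q0w] := leP 0 (ev w q.[0]).
    by rewrite subrr mul0r mulr0.
  have [q1w|/ltW q1w] := leP 0 (ev w q.[1]).
    by have [_ ->] := cP w; rewrite ?q0w ?q1w ?mul0r.
  by rewrite hP ?rmorphN ?oppr_ge0// subrr !mulr0.
rewrite !rmorphM !mulf_eq0 rmorphB rmorphD !rmorphXn subr_eq0 addr_eq0.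
case/or3P=> /eqP // e; exfalso.
  by move/eqP: q00; apply; apply: sq_anti => //; exists (psi g).
move/eqP: q10; apply; apply: sq_anti => //; exists (psi h).
by rewrite e opprK.
Qed.

End Fractions.


(** * Residue fields at prime ideals *)

Lemma fractionP (D : idomainType) (x : {fraction D}) :
  exists a b : D, b != 0 /\ x = tofrac a / tofrac b.
Proof.
elim/quotW: x => r; exists (\n_r)%qT, (\d_r)%qT.
have d0 : tofrac (\d_r) != 0 by rewrite tofrac_eq0 denom_ratioP.
split; first exact: denom_ratioP.
apply: (mulIf d0); rewrite divfK //; unlock FracField.tofrac.
rewrite -[LHS]FracField.pi_mul; apply/eqmodP; rewrite /= FracField.equivfE.
rewrite !numden_Ratio ?oner_neq0 ?mulr1 ?mulf_neq0 ?denom_ratioP //.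
by rewrite mulrC.
Qed.

Section ResidueFields.
Variables (A : comNzRingType) (W : Type) (K : rcfType).
Variable ev : W -> {rmorphism A -> K}.
Hypothesis ivtA : ivt_function_ring ev.

Section Residue.
Variable P : prime_idealr A.

Definition to_residue : {rmorphism A -> residue P} := \pi_{ideal_quot P}%qT.

Definition residue_class : {rmorphism A -> residue_field P} :=
  @tofrac (residue P) \o to_residue.

Lemma to_residue_surj d : exists a, d = to_residue a.
Proof. by exists (repr d); rewrite /to_residue /= reprK. Qed.

Lemma residue_class_eq0 a : (residue_class a == 0) = (a \in P).
Proof.
rewrite tofrac_eq0 -(rmorph0 to_residue) /to_residue /= -Quotient.idealrBE.
by rewrite subr0.
Qed.

Lemma residue_classP x :
  exists a b, residue_class b != 0 /\ x = residue_class a / residue_class b.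
Proof.
have [d [e [e0 ->]]] := fractionP x.
have [[a ->] [b bE]] := (to_residue_surj d, to_residue_surj e).
by exists a, b; rewrite {1}/residue_class /= -bE tofrac_eq0.
Qed.

Lemma residue_field_real_closed : real_closed_field (residue_field P).
Proof. exact (real_closed_field_of_fractions ivtA residue_classP). Qed.

(** The residue domain is a valuation ring: by [frac_valuation], of any two elements one divides the
    other. *)
Lemma residue_integrally_closed : integrally_closed (@to_residue_field A P).
Proof.
apply: (@valuation_integrally_closed _ _ (@tofrac (residue P))) => [x|d e].
  by have [d [e [e0 xE]]] := fractionP x; exists d, e; rewrite tofrac_eq0.
have [[a ->] [b ->]] := (to_residue_surj d, to_residue_surj e).
have [[c cE]|[c cE]] := frac_valuation ivtA residue_class a b; [left|right];
  by exists (to_residue c).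
Qed.

End Residue.

Lemma ivt_real_closed_ring : real_closed_ring A.
Proof.
split=> [x n|| P]; first exact: ivt_reduced ivtA _ _.
  exists (pw_le ev); split=> [||a b a0 ab]; first exact: pw_f_ring ivtA.
    exact: pw_sqrE ivtA.
  have [c cE] := pw_dvd ivtA a0 ab; exists (c * a).
  by rewrite expr2 {1}cE mulrAC.
split; [exact: residue_field_real_closed|exact: residue_integrally_closed].
Qed.

End ResidueFields.

(** * A countable non-Archimedean real closed field *)

Lemma countable_range (I : countType) (T : Type) (f : I -> T) (A : set T) :
  A `<=` range f -> countable A.
Proof.
move=> /subset_card_le Af; apply: sub_countable Af _.
exact: sub_countable (card_image_le _ _) (countableP _).
Qed.

(** A choice made from [p], [a] and [b] alone: where these data agree, so do the chosen roots. This
    keeps almost constant functions almost constant. *)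
Definition ivt_witness (K : rcfType) (p : {poly K}) (a b : K) : K :=
  xget a [set c | a <= c <= b /\ (p.[a] <= 0 <= p.[b] -> p.[c] = 0)].

Lemma ivt_witnessP (K : rcfType) (p : {poly K}) (a b : K) : a <= b ->
  a <= ivt_witness p a b <= b /\
  (p.[a] <= 0 <= p.[b] -> p.[ivt_witness p a b] = 0).
Proof.
move=> ab; rewrite /ivt_witness; case: xgetP => // noc.
have [/(poly_ivt ab)[c cab /eqP pc]|npab] := boolP (p.[a] <= 0 <= p.[b]).
  by case: (noc c).
by case: (noc a); split=> [|pab]; [rewrite lexx ab|case/negP: npab].
Qed.

(* Operation [k] acts on its list of arguments; those with [k >= 4] take
   [a], [b] and then the coefficients of a polynomial to a root in [a, b]. *)
Definition skolem_op (K : rcfType) (k : nat) (s : seq (nat -> K)) : nat -> K :=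
  match k with
  | 0 => fun=> 1
  | 1 => s`_0 - s`_1
  | 2 => s`_0 * s`_1
  | 3 => fun n => n.+1%:R^-1
  | _ => fun n => ivt_witness (Poly [seq f n | f <- drop 2 s]) (s`_0 n) (s`_1 n)
  end.

(** Trees with natural labels serve as terms because they form a countable type; every leaf denotes
    0. *)
Fixpoint skolem_eval (K : rcfType) (t : GenTree.tree nat) : nat -> K :=
  match t with
  | GenTree.Leaf _ => 0
  | GenTree.Node k ts => skolem_op k [seq skolem_eval K t | t <- ts]
  end.

Definition skolem_hull (K : rcfType) : pred (nat -> K) :=
  fun f => `[< range (@skolem_eval K) f >].

Lemma skolem_hull_op (K : rcfType) k (s : seq (nat -> K)) :
  all (@skolem_hull K) s -> skolem_hull (skolem_op k s).
Proof.
move=> sP; suff [ts <-] : exists ts, [seq skolem_eval K t | t <- ts] = s.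
  by apply/asboolP; exists (GenTree.Node k ts).
elim: s sP => [|f s IHs] /=; first by exists [::].
by move=> /andP[/asboolP[t _ <-] /IHs[ts <-]]; exists (t :: ts).
Qed.

Lemma skolem_hull_subring (K : rcfType) : subring_closed (@skolem_hull K).
Proof.
split=> [|f g hf hg|f g hf hg].
- exact: (@skolem_hull_op K 0 [::]).
- by apply: (@skolem_hull_op K 1 [:: f; g]); apply/and3P.
- by apply: (@skolem_hull_op K 2 [:: f; g]); apply/and3P.
Qed.

HB.instance Definition _ (K : rcfType) :=
  GRing.isSubringClosed.Build _ (@skolem_hull K) (@skolem_hull_subring K).

Record hull (K : rcfType) := Hull {
  hull_val :> nat -> K;
  hull_valP : skolem_hull hull_val
}.

HB.instance Definition _ (K : rcfType) := [isSub for @hull_val K].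
HB.instance Definition _ (K : rcfType) := [Choice of hull K by <:].
HB.instance Definition _ (K : rcfType) :=
  [SubChoice_isSubComNzRing of hull K by <:].

Section HullEvaluation.
Variables (K : rcfType) (n : nat).

Definition hull_ev (f : hull K) : K := val f n.

Lemma hull_ev_zmod : zmod_morphism hull_ev. Proof. by []. Qed.

Lemma hull_ev_monoid : monoid_morphism hull_ev. Proof. by []. Qed.

HB.instance Definition _ := GRing.isZmodMorphism.Build _ _ hull_ev hull_ev_zmod.
HB.instance Definition _ :=
  GRing.isMonoidMorphism.Build _ _ hull_ev hull_ev_monoid.

End HullEvaluation.

Lemma hull_ivt (K : rcfType) : ivt_function_ring (@hull_ev K).
Proof.
split=> [f g fg|p a b ab]; first by apply/val_inj/funext.
have h : skolem_hull (skolem_op 4 [:: val a, val b & [seq val f | f <- p]]).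
  apply: skolem_hull_op; apply/and3P; split; [exact: hull_valP..|].
  by apply/allP => _ /mapP[f _ ->]; apply: hull_valP.
exists (Hull h) => n; have hE : hull_ev n (Hull h) =
    ivt_witness (map_poly (hull_ev n) p) (hull_ev n a) (hull_ev n b).
  by rewrite /hull_ev /= drop0 map_polyE -map_comp.
have := ivt_witnessP (map_poly (hull_ev n) p) (ab n).
by rewrite -hE !horner_map.
Qed.

Lemma hull_countable (K : rcfType) : countable [set: hull K].
Proof.
pose code (f : hull K) : GenTree.tree nat :=
  projT1 (cid2 (elimT (asboolP _) (hull_valP f))).
have codeP f : skolem_eval K (code f) = val f by rewrite /code; case: cid2.
apply: (@countable_range _ _ (fun t =>
  if pselect (skolem_hull (skolem_eval K t)) is left h then Hull h else 0)).
move=> f _; exists (code f) => //; case: pselect => [h|[]].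
  by apply: val_inj; rewrite /= codeP.
by rewrite codeP; apply: hull_valP.
Qed.

(** * Quotient of the hull by an ultrafilter *)

Section UltraPrime.
Variables (K : rcfType) (U : set_system nat) (FU : UltraFilter U).

Definition ultra_null : pred (hull K) :=
  fun f => `[< U [set n | hull_ev n f = 0] >].

Lemma ultra_null_ideal : idealr_closed ultra_null.
Proof.
split=> [||a f g /asboolP Uf /asboolP Ug].
- by apply/asboolP; apply: filterS filterT => n _ /=; rewrite rmorph0.
- apply/negP => /asboolP /filter_ex[n] /=; rewrite rmorph1.
  by move/eqP; rewrite oner_eq0.
apply/asboolP; apply: filterS (filterI Uf Ug) => n /= [fn gn].
by rewrite rmorphD rmorphM /= fn gn mulr0 addr0.
Qed.

(** An ultrafilter contains the zero set of [f] or its complement, and on the complement [g]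
    vanishes wherever [f * g] does. *)
Lemma ultra_null_prime : prime_idealr_closed ultra_null.
Proof.
move=> f g /asboolP Ufg; apply/orP.
have [Uf|Uf] := in_ultra_setVsetC [set n | hull_ev n f = 0] FU.
  by left; apply/asboolP.
right; apply/asboolP; apply: filterS (filterI Uf Ufg) => n /= [fn].
by rewrite rmorphM /= => /eqP; rewrite mulf_eq0 => /orP[]/eqP.
Qed.

End UltraPrime.

Lemma countable_nonarchimedean_rcf : exists K : rcfType,
  countable [set: K] /\ exists t : K, 0 < t /\ forall n, t *+ n <= 1.
Proof.
pose R := algR.
(* [U] refines the filter of cofinite sets, so only tails of sequences matter. *)
have [U [FU cofU]] := ultraFilterLemma eventually_filter.
pose P : prime_idealr (hull R) := HB.pack (@ultra_null R U)
  (isIdealr.Build _ _ (@ultra_null_ideal R U FU))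
  (isPrimeIdealrClosed.Build _ _ (@ultra_null_prime R U FU)).
have [K [f [g fK gK]]] := residue_field_real_closed (hull_ivt R) P.
pose psi : {rmorphism hull R -> K} := f \o residue_class P.
(* The order of [K] is known only through an abstract isomorphism, so nonnegativity is transported
   by exhibiting a square. *)
have psi_ge0 a : (\forall n \near \oo, 0 <= hull_ev n a) -> 0 <= psi a.
  move=> a0; have [c _ cP] := pw_sqrt (hull_ivt R) a.
  suff -> : psi a = psi c ^+ 2 by apply: sqr_ge0.
  apply/eqP; rewrite -rmorphXn -subr_eq0 -rmorphB /psi /= fmorph_eq0.
  rewrite residue_class_eq0; apply/asboolP; apply: cofU.
  apply: filterS a0 => n /= /cP e; rewrite rmorphB rmorphXn /=.
  by rewrite e subrr.
exists K; split.
  have cR := hull_countable R; have := countableX cR cR; apply: sub_countable.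
  pose h ab : K := f (residue_class P ab.1 / residue_class P ab.2).
  apply: card_le_trans (card_image_le h _); apply: subset_card_le => x _.
  have [a [b [_ xE]]] := residue_classP (g x); exists (a, b) => //.
  by rewrite /h /= -xE gK.
(* The infinitesimal is the class of the sequence [1 / (n + 1)]: it is nowhere 0, and any fixed
   multiple of it is eventually at most 1. *)
have h : skolem_hull (@skolem_op R 3 [::]) by apply: skolem_hull_op.
exists (psi (Hull h)); split=> [|n].
  rewrite lt_neqAle psi_ge0 ?andbT; last first.
    by apply: nearW => n; rewrite invr_ge0 ler0n.
  rewrite eq_sym /psi /= fmorph_eq0 residue_class_eq0; apply/negP => /asboolP.
  move=> /filter_ex[n] /= /eqP; rewrite invr_eq0 pnatr_eq0.
  by [].
rewrite -subr_ge0 -(rmorph1 psi) -rmorphMn -rmorphB; apply: psi_ge0.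
near=> k; rewrite rmorphB rmorphMn rmorph1 subr_ge0 /= /hull_ev /=.
rewrite -mulr_natr ler_pdivrMl ?ltr0n// mulr1 ler_nat.
near: k; exists n => // k /= nk; exact: leqW.
Unshelve. all: by end_near.
Qed.

(** * The first uncountable ordinal *)

Lemma cantor_uncountable : ~ countable [set: nat -> bool].
Proof.
move=> /countable_injP[e einj].
have {}einj f g : e f = e g -> f = g by apply: einj; rewrite inE.
pose D n := `[< exists f : nat -> bool, e f = n /\ f n = false >].
have nDD : D (e D) = false.
  apply/negP => /[dup] DD /asboolP[f [/einj->]]; by rewrite DD.
by move/negbT: (nDD) => /asboolP; apply; exists D.
Qed.

Lemma well_order_total (T : eqType) (le : rel T) : well_order le ->
  [/\ reflexive le, antisymmetric le, transitive le & total le].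
Proof.
move=> wo; have woT : wo_chain le predT by move=> A _; apply: wo.
have lrefl x : le x x by apply: (wo_chain_reflexive woT).
have lanti : antisymmetric le.
  by move=> x y; apply: (wo_chain_antisymmetric woT).
split=> [//|//|y x z xy yz|x y]; last exact: (wo_chainW woT).
(* Transitivity comes from the least of [x], [y], [z]: if it is [y] or [z], antisymmetry identifies
   it with its predecessor. *)
have [|m [[+ mmin] _]] := wo (mem [:: x; y; z]).
  by exists x; rewrite !inE eqxx.
have [mx my mz] : [/\ le m x, le m y & le m z].
  by split; apply: mmin; rewrite !inE eqxx ?orbT.
rewrite !inE => /or3P[]/eqP e; rewrite e in mx my mz.
- by [].
- by rewrite (lanti x y) ?xy.
- by rewrite -(lanti y z) ?yz.
Qed.

Lemma countableU (T : Type) (A B : set T) :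
  countable A -> countable B -> countable (A `|` B).
Proof.
by move=> cA cB; rewrite -bigcup2E; apply: bigcup_countable => // -[|[|i]].
Qed.

(** A well-order of [nat -> bool] is taken as it stands if its initial segments are countable;
    otherwise [W] consists of the strict predecessors of the least element whose initial segment is
    uncountable. *)
Lemma exists_aleph1 : exists (W : choiceType) (le : rel W),
  [/\ well_order le, ~ countable [set: W] &
      forall x, countable [set y | le y x]].
Proof.
pose T : choiceType := nat -> bool; have [R wo] := well_ordering_principle T.
have [Rrefl Ranti _ _] := well_order_total wo.
have [cR|] := pselect (forall x : T, countable [set y | R y x]).
  by exists T, R; split=> //; exact: cantor_uncountable.
move=> /existsNP[x1 ncx1].
have [|x [[/asboolP ncx xmin] _]] :=
    wo (fun x => `[< ~ countable [set y | R y x] >]).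
  by exists x1; apply/asboolP.
pose W : choiceType := {y : T | R y x && (y != x)}.
exists W, (fun u v => R (val u) (val v)); split=> [B [b Bb]|cW|w].
- have [|z [[/asboolP[u Bu uz] zmin] _]] :=
      wo (fun y => `[< exists2 u, u \in B & val u = y >]).
    by exists (val b); apply/asboolP; exists b.
  have umin : lower_bound (fun u v : W => R (val u) (val v)) B u.
    by move=> v Bv; rewrite /= uz; apply: zmin; apply/asboolP; exists v.
  exists u; split=> // v [Bv vmin]; apply/val_inj/Ranti.
  by rewrite umin // vmin.
- apply: ncx; have : countable ([set x] `|` [set val w | w in [set: W]]).
    apply: countableU; first exact: countable1.
    exact: sub_countable (card_image_le _ _) cW.
  apply: sub_countable; apply: subset_card_le => y /= Ryx.
  have [->|yx] := eqVneq y x; first by left.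
  have h : R y x && (y != x) by rewrite Ryx.
  by right; exists (Sub y h).
- have cw : countable [set y | R y (val w)].
    apply: contrapT => ncw; have /andP[wx /eqP] := valP w; apply.
    apply: Ranti; rewrite wx /=; apply: xmin; exact/asboolP.
  apply/countable_injP; have /countable_injP[e einj] := cw.
  exists (e \o val) => u v; rewrite !inE => uw vw.
  by move=> /= euv; apply/val_inj/einj; rewrite ?inE.
Qed.

(** [T] is ordered by rank, ties being broken by an arbitrary well-order; all predecessors of [x]
    then have rank at most [rho x]. *)
Lemma aleph1_rank (T W : eqType) (le : rel W) (rho : T -> W) :
  well_order le -> ~ countable [set: T] ->
  (forall w, countable [set t | le (rho t) w]) -> has_card_aleph1 T.
Proof.
move=> wo ncT crho; have [R woR] := well_ordering_principle T.
have [lrefl lanti _ _] := well_order_total wo.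
have [_ Ranti _ _] := well_order_total woR.
exists (fun x y => if rho x == rho y then R x y else le (rho x) (rho y)).
split=> // [B [b Bb]|x].
  have [|w [[/asboolP[x Bx xw] wmin] _]] :=
      wo (fun w => `[< exists2 x, x \in B & rho x = w >]).
    by exists (rho b); apply/asboolP; exists b.
  have [|z [[/andP[Bz /eqP zw] zmin] _]] :=
      woR [pred x | (x \in B) && (rho x == w)].
    by exists x; rewrite !inE Bx xw eqxx.
  have lemin : lower_bound
      (fun x y => if rho x == rho y then R x y else le (rho x) (rho y)) B z.
    move=> y By /=; case: eqVneq => [zy|_].
      by apply: zmin; rewrite !inE By -zy zw eqxx.
    by rewrite zw; apply: wmin; apply/asboolP; exists y.
  exists z; split=> // y [By ymin].
  have := lemin _ By; have := ymin _ Bz; rewrite eq_sym.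
  case: eqVneq => [_ yz zy|zy yz' zy'].
    by apply: Ranti; rewrite zy yz.
  by case/eqP: zy; apply: lanti; rewrite zy' yz'.
apply: sub_countable (crho (rho x)); apply: subset_card_le => y /=.
by case: eqVneq => [-> _|//]; apply: lrefl.
Qed.

(** * The ring of almost constant functions *)

Section AlmostConstant.
Variables (W : pointedType) (K : rcfType).
Implicit Types f g : W -> K.

Definition exceptional f : set W := [set w | f w <> f point].

Definition bounded_elt (x : K) : Prop := exists n : nat, `|x| <= n%:R.

(** Bounded limits make those that are infinitesimal absorb products; the values elsewhere fill all
    of [K], which is what makes the corresponding points of the real spectrum closed. *)
Definition almost_const : pred (W -> K) :=
  fun f => `[< bounded_elt (f point) /\ finite_set (exceptional f) >].

Lemma bounded_elt_le x y : `|x| <= y -> bounded_elt y -> bounded_elt x.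
Proof.
move=> xy [n yn]; exists n; apply: le_trans yn.
by rewrite (le_trans xy)// ler_norm.
Qed.

Lemma bounded_eltD x y :
  bounded_elt x -> bounded_elt y -> bounded_elt (`|x| + `|y|).
Proof.
move=> [m xm] [n yn]; exists (m + n)%N.
by rewrite ger0_norm ?addr_ge0// natrD lerD.
Qed.

Lemma almost_const_subring : subring_closed almost_const.
Proof.
have fin2 (h : K -> K -> K) f g : finite_set (exceptional f) ->
    finite_set (exceptional g) ->
    finite_set (exceptional (fun w => h (f w) (g w))).
  move=> ff fg.
  apply: (@sub_finite_set _ _ (exceptional f `|` exceptional g)).
    move=> w; apply: contra_notP => /not_orP[/contrapT fw /contrapT gw].
    by rewrite fw gw.
  by rewrite finite_setU.
split=> [|f g /asboolP[bf ff] /asboolP[bg fg]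
          |f g /asboolP[bf ff] /asboolP[bg fg]]; apply/asboolP.
- split; first by exists 1%N; rewrite normr1.
  by rewrite (_ : exceptional _ = set0) //; apply/seteqP; split=> w //; case.
- split; last exact: (fin2 (fun x y => x - y)).
  exact: bounded_elt_le (ler_normB _ _) (bounded_eltD _ _).
- split; last exact: (fin2 (fun x y => x * y)).
  have [[m xm] [n yn]] := (bf, bg); exists (m * n)%N.
  by rewrite normrM natrM ler_pM.
Qed.

HB.instance Definition _ :=
  GRing.isSubringClosed.Build _ almost_const almost_const_subring.

Record acring := AcRing {
  acring_val :> W -> K;
  acring_valP : almost_const acring_val
}.

HB.instance Definition _ := [isSub for acring_val].
HB.instance Definition _ := [Choice of acring by <:].
HB.instance Definition _ := [SubChoice_isSubComNzRing of acring by <:].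

Lemma acring_bounded (f : acring) : bounded_elt (f point).
Proof. by have /asboolP[] := acring_valP f. Qed.

Lemma acring_finite (f : acring) : finite_set (exceptional f).
Proof. by have /asboolP[] := acring_valP f. Qed.

Section Evaluation.
Variable w : W.

Definition acring_ev (f : acring) : K := val f w.

Lemma acring_ev_zmod : zmod_morphism acring_ev. Proof. by []. Qed.

Lemma acring_ev_monoid : monoid_morphism acring_ev. Proof. by []. Qed.

HB.instance Definition _ :=
  GRing.isZmodMorphism.Build _ _ acring_ev acring_ev_zmod.
HB.instance Definition _ :=
  GRing.isMonoidMorphism.Build _ _ acring_ev acring_ev_monoid.

End Evaluation.

(** The chosen root is bounded at [point], lying there between two bounded values, and it equals its
    value at [point] outside the exceptional sets of [a], [b] and the finitely many coefficients of
    [p]. *)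
Lemma acring_ivt : ivt_function_ring acring_ev.
Proof.
split=> [f g fg|p a b ab]; first by apply/val_inj/funext.
pose c w :=
  ivt_witness (map_poly (acring_ev w) p) (acring_ev w a) (acring_ev w b).
have cP w := ivt_witnessP (map_poly (acring_ev w) p) (ab w).
have h : almost_const c.
  apply/asboolP; split.
    have := bounded_eltD (acring_bounded a) (acring_bounded b).
    apply: bounded_elt_le; have [/andP[]] := cP point.
    rewrite -/(c point) /acring_ev /= => ac cb _.
    rewrite ler_norml; apply/andP; split.
      apply: le_trans ac; rewrite lerNl; apply: le_trans (ler_norm _) _.
      by rewrite normrN lerDl.
    by apply: le_trans cb _; apply: le_trans (ler_norm _) _; rewrite lerDr.
  apply: sub_finite_set (_ : finite_set (exceptional a `|` exceptional b `|`
    \bigcup_(i in `I_(size p)) exceptional (p`_i))); last first.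
    rewrite !finite_setU; split; first by split; apply: acring_finite.
    by apply: bigcup_finite => // i _; apply: acring_finite.
  move=> w; apply: contra_notP.
  move=> /not_orP[/not_orP[/contrapT aw /contrapT bw] pw].
  rewrite /c; congr ivt_witness => //; apply/polyP => i; rewrite !coef_map /=.
  have [ip|ip] := ltnP i (size p); last by rewrite nth_default// !rmorph0.
  by apply: contrapT => piw; apply: pw; exists i.
exists (AcRing h) => w; have := cP w.
by rewrite -[ivt_witness _ _ _]/(acring_ev w (AcRing h)) !horner_map.
Qed.

End AlmostConstant.

(** * Cardinality of the ring *)

Section AlmostConstantCardinality.
Variables (W : pointedType) (K : rcfType) (le : rel W).
Hypothesis le_wo : well_order le.
Hypothesis W_uncountable : ~ countable [set: W].
Hypothesis le_countable : forall w, countable [set v | le v w].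
Hypothesis K_countable : countable [set: K].

(** The test against [point] forces the limit value 0, so that [x] may be unbounded. *)
Definition spike (w : W) (x : K) : W -> K :=
  fun v => if (v == w) && (w != point) then x else 0.

Lemma spikeP w x : almost_const (spike w x).
Proof.
apply/asboolP; split.
  exists 0%N; rewrite /spike; by case: eqVneq => _; rewrite normr0.
apply: sub_finite_set (finite_set1 w) => v; apply: contra_notP => /eqP vw.
by rewrite /spike (negPf vw) /=; case: eqVneq.
Qed.

Lemma acring_uncountable : ~ countable [set: acring W K].
Proof.
move=> /countable_injP[e einj]; apply: W_uncountable; apply/countable_injP.
exists (fun w => e (AcRing (spikeP w 1))) => u v _ _ /einj.
rewrite !inE => /(_ I I) /(congr1 val) /= uv.
have [u0|u0] := eqVneq u point; last first.
  have := congr1 (@^~ u) uv; rewrite /spike eqxx u0 /=.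
  by case: eqVneq => // _ /eqP; rewrite oner_eq0.
have := congr1 (@^~ v) uv; rewrite /spike eqxx u0 eqxx andbF /=.
by case: eqVneq => // _ /esym/eqP; rewrite oner_eq0.
Qed.

(** A function is coded by its limit value and the finite list of its exceptional points paired with
    their values. *)
Lemma countable_supported (S : set W) : countable S ->
  countable [set f : acring W K | exceptional (val f) `<=` S].
Proof.
move=> /countable_injP[eS eSinj]; have /countable_injP[eK eKinj] := K_countable.
have {}eKinj x y : eK x = eK y -> x = y by apply: eKinj; rewrite inE.
have /choice[s sP] (f : acring W K) :
    exists s : seq W, exceptional (val f) = [set` s].
  exact/finite_seqP/acring_finite.
have sE f v : v \in s f <-> exceptional (val f) v by rewrite sP.
pose code f := (eK (val f point), [seq (eS w, eK (val f w)) | w <- s f]).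
apply/countable_injP; exists (pickle \o code) => f g /set_mem fS /set_mem gS.
move=> /(pcan_inj pickleK)[/eKinj fg0 fg]; apply/val_inj/funext => w.
have step (f1 g1 : acring W K) : exceptional (val f1) `<=` S ->
    exceptional (val g1) `<=` S ->
    [seq (eS w, eK (val f1 w)) | w <- s f1] =
    [seq (eS w, eK (val g1 w)) | w <- s g1] ->
    exceptional (val f1) w -> val f1 w = val g1 w.
  move=> f1S g1S fg1 /[dup] f1w /sE wf1.
  have : (eS w, eK (val f1 w)) \in [seq (eS w, eK (val f1 w)) | w <- s f1].
    exact: map_f.
  rewrite fg1 => /mapP[v /sE g1v [/eSinj wv /eKinj f1g1]].
  by apply: etrans f1g1 _; rewrite wv// inE; [apply: f1S|apply: g1S].
have [fw|/contrapT fw] := pselect (exceptional (val f) w).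
  exact: step fg fw.
have [gw|/contrapT gw] := pselect (exceptional (val g) w).
  by apply/esym; exact: step (esym fg) gw.
by rewrite fw gw.
Qed.

(** The rank of [f] is an upper bound of its finite exceptional set, so functions of rank at most
    [w] are exceptional only on a countable initial segment. *)
Lemma acring_aleph1 : has_card_aleph1 (acring W K).
Proof.
have [lrefl lanti ltrans ltot] := well_order_total le_wo.
have bnd (s : seq W) : exists u, forall w, w \in s -> le w u.
  elim: s => [|v s [u us]]; first by exists point.
  have [uv|vu] := orP (ltot u v).
    exists v => w; rewrite inE => /orP[/eqP->|/us wu]; first exact: lrefl.
    exact: ltrans uv.
  by exists u => w; rewrite inE => /orP[/eqP->|/us].
have /choice[rho rhoP] (f : acring W K) :
    exists u, forall w, exceptional (val f) w -> le w u.
  have /finite_seqP[s sE] := acring_finite f; have [u us] := bnd s.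
  by exists u => w; rewrite sE => /us.
apply: (@aleph1_rank _ _ le rho) => // [|w]; first exact: acring_uncountable.
apply: sub_countable (countable_supported (le_countable w)).
by apply: subset_card_le => f /= fw v /rhoP vf; apply: ltrans fw.
Qed.

End AlmostConstantCardinality.

(** * Prime l-ideals and the l-spectrum *)

Section LIdeals.
Variable G : abLGroup.
Implicit Types (x y z : G) (I P : set G).
Local Notation le := (@lgroup_le G).

Let lexx x : le x x := lo_refl (lgroup_lattice G) x.

Let le_trans := lo_trans (lgroup_lattice G).

Lemma lgroup_leD x y z t : le x y -> le z t -> le (x + z) (y + t).
Proof.
move=> xy zt; apply: (le_trans (lgroup_translation x zt)).
by rewrite ![_ + t]addrC; apply: lgroup_translation.
Qed.

Lemma lgroup_subr_ge0 x y : le 0 (y - x) <-> le x y.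
Proof.
split=> [/(lgroup_translation x)|/(lgroup_translation (- x))].
  by rewrite addr0 subrKC.
by rewrite addNr addrC.
Qed.

Lemma lgroup_leN x y : le x y -> le (- y) (- x).
Proof.
by move=> /lgroup_subr_ge0 h; apply/lgroup_subr_ge0; rewrite opprK addrC.
Qed.

Section Ideal.
Variable I : set G.
Hypothesis idealI : lideal I.

Lemma lideal0 : I 0.
Proof. by have [[/set_mem]] := idealI. Qed.

Lemma lidealB x y : I x -> I y -> I (x - y).
Proof.
by have [[_ IB] _ _ _] := idealI => Ix Iy; apply/set_mem/IB; apply/mem_set.
Qed.

Lemma lidealN x : I x -> I (- x).
Proof. by move=> Ix; rewrite -sub0r; apply: lidealB => //; exact: lideal0. Qed.

Lemma lidealD x y : I x -> I y -> I (x + y).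
Proof.
by move=> Ix Iy; rewrite -[y]opprK; apply: lidealB => //; apply: lidealN.
Qed.

Lemma lidealMn x n : I x -> I (x *+ n).
Proof.
move=> Ix; elim: n => [|n In]; first by rewrite mulr0n; exact: lideal0.
by rewrite mulrS; apply: lidealD.
Qed.

Lemma lideal_convex x y z : I x -> I y -> le x z -> le z y -> I z.
Proof. by have [_ convI _ _] := idealI; exact: convI. Qed.

End Ideal.

(** [a] is the absolute value, built as the sum of the positive parts of [x] and [- x]. *)
Lemma lgroup_abs x : exists a, [/\ le 0 a, le x a, le (- x) a &
  forall I, lideal I -> (I a <-> I x)].
Proof.
have [j /[dup] jP [xj j0 _]] := lo_join (lgroup_lattice G) x 0.
have [k /[dup] kP [xk k0 _]] := lo_join (lgroup_lattice G) (- x) 0.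
have aP : le x (j + k) /\ le (- x) (j + k).
  split; first by rewrite -[x]addr0; apply: lgroup_leD.
  by rewrite -[- x]add0r; apply: lgroup_leD.
exists (j + k); split; [|by have [] := aP|by have [] := aP|move=> I idealI].
  by rewrite -[0]addr0; apply: lgroup_leD.
split=> [Ia|Ix].
  apply: (lideal_convex idealI (lidealN idealI Ia) Ia); last by have [] := aP.
  by rewrite -[x]opprK; apply: lgroup_leN; have [] := aP.
have [_ _ _ joinI] := idealI; have I0 := lideal0 idealI.
apply: lidealD => //; first exact: joinI Ix I0 jP.
exact: joinI (lidealN idealI Ix) I0 kP.
Qed.

Section PrimeExtension.
Variables (P : set G) (y : G).
Hypotheses (primeP : prime_lideal P) (y0 : le 0 y).

Let idealP : lideal P. Proof. by have [] := primeP. Qed.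

Definition lideal_adjoin : set G :=
  [set x | exists n z, P z /\ le x (y *+ n + z) /\ le (- x) (y *+ n + z)].

Let subP : P `<=` lideal_adjoin.
Proof.
move=> x Px; have [a [_ xa nxa aP]] := lgroup_abs x.
by exists 0%N, a; rewrite mulr0n add0r; split=> //; apply/aP.
Qed.

Let oppA x : lideal_adjoin x -> lideal_adjoin (- x).
Proof. by move=> [n [z [Pz [xz nxz]]]]; exists n, z; rewrite opprK. Qed.

Let addA x t : lideal_adjoin x -> lideal_adjoin t -> lideal_adjoin (x + t).
Proof.
move=> [n [z [Pz [xz nxz]]]] [m [v [Pv [tv ntv]]]].
exists (n + m)%N, (z + v); rewrite opprD mulrnDr addrACA.
by split; [apply: lidealD|split; apply: lgroup_leD].
Qed.

(* Upper bounds of the two elements are merged by making their [P]-parts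
   nonnegative and adding them. *)
Let boundA x t : lideal_adjoin x -> lideal_adjoin t ->
  exists n z, [/\ P z, le x (y *+ n + z), le (- x) (y *+ n + z),
                  le t (y *+ n + z) & le (- t) (y *+ n + z)].
Proof.
have ny0 n : le 0 (y *+ n).
  elim: n => [|n yn]; first by rewrite mulr0n.
  by rewrite mulrS -[0]addr0; apply: lgroup_leD.
have grow n m z a b :
    le 0 b -> le z a -> le (y *+ n + z) (y *+ (n + m) + (a + b)).
  move=> b0 za; rewrite mulrnDr addrACA -[X in le X _]addr0.
  apply: lgroup_leD; first exact: lgroup_leD.
  by rewrite -[0]addr0; apply: lgroup_leD.
move=> [n [z [Pz [xz nxz]]]] [m [v [Pv [tv ntv]]]].
have [a [a0 za _ aP]] := lgroup_abs z; have [b [b0 vb _ bP]] := lgroup_abs v.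
have gn := grow n m z a b b0 za.
have gm := grow m n v b a a0 vb; rewrite addnC [b + a]addrC in gm.
exists (n + m)%N, (a + b); split.
- by apply: lidealD => //; [apply/aP|apply/bP].
- exact: le_trans xz gn.
- exact: le_trans nxz gn.
- exact: le_trans tv gm.
- exact: le_trans ntv gm.
Qed.

Let convA x t z : lideal_adjoin x -> lideal_adjoin t -> le x z -> le z t ->
  lideal_adjoin z.
Proof.
move=> Ax At xz zt; have [n [v [Pv _ nxv tv _]]] := boundA Ax At.
exists n, v; split=> //; split; first exact: le_trans zt tv.
exact: le_trans (lgroup_leN xz) nxv.
Qed.

(** A proper l-ideal containing a prime one is prime: if [m] is the meet of [x] and [t], then
    [x - m] and [t - m] have meet 0, so one of them is in [P]. The element [u] witnesses
    properness. *)
Lemma lideal_adjoin_prime u : (forall n z, P z -> ~ le u (y *+ n + z)) ->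
  prime_lideal lideal_adjoin.
Proof.
move=> nu; split=> [||x t m [mx mt mP] Am].
- split=> [|x t z|x t m Ax At [mx mt mP]|x t j Ax At [xj tj jP]].
  + split; first by apply/mem_set/subP/(lideal0 idealP).
    move=> x t /set_mem Ax /set_mem At; apply/mem_set.
    by apply: addA => //; apply: oppA.
  + exact: convA.
  + have [n [z [Pz xz nxz tz ntz]]] := boundA Ax At.
    exists n, z; split=> //; split; first exact: le_trans mx xz.
    rewrite -[X in le _ X]opprK; apply/lgroup_leN/mP.
      by rewrite -[x]opprK; apply: lgroup_leN.
    by rewrite -[t]opprK; apply: lgroup_leN.
  + have [n [z [Pz xz nxz tz ntz]]] := boundA Ax At.
    exists n, z; split=> //; split; first exact: jP.
    exact: le_trans (lgroup_leN xj) nxz.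
- move=> AT; have : lideal_adjoin u by rewrite AT.
  by move=> [n [z [Pz [uz _]]]]; exact: nu uz.
- have [_ _ primP] := primeP.
  have meet0 : is_meet le (x - m) (t - m) 0.
    split; [exact/lgroup_subr_ge0|exact/lgroup_subr_ge0|move=> z zx zt].
    apply/lgroup_subr_ge0; rewrite sub0r.
    have : le (m + z) m.
      apply: mP; first by move: (lgroup_translation m zx); rewrite subrKC.
      by move: (lgroup_translation m zt); rewrite subrKC.
    by move=> /lgroup_subr_ge0; rewrite opprD addNKr.
  have [Px|Pt] := primP _ _ _ meet0 (lideal0 idealP); [left|right].
    by rewrite -(subrK m x); apply: addA => //; apply: subP.
  by rewrite -(subrK m t); apply: addA => //; apply: subP.
Qed.

Lemma sub_lideal_adjoin : P `<=` lideal_adjoin. Proof. exact: subP. Qed.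

Lemma mem_lideal_adjoin : lideal_adjoin y.
Proof.
exists 1%N, 0; rewrite addr0 mulr1n; split; first exact: lideal0 idealP.
split=> //; have := lgroup_leN y0; rewrite oppr0 => ny0.
exact: le_trans ny0 y0.
Qed.

End PrimeExtension.

End LIdeals.

(** * Specialisation in the l-spectrum and the topological obstruction *)

Lemma lspec_eq (G : abLGroup) (P Q : lspec G) :
  lspec_set P = lspec_set Q -> P = Q.
Proof.
case: P Q => [P hP] [Q hQ] /= PQ; move: hP; rewrite PQ => hP.
by congr LSpec; exact: Prop_irrelevance.
Qed.

Lemma lspec_open_notin (G : abLGroup) (x : G) :
  open [set P : lspec G | ~ lspec_set P x].
Proof.
rewrite -closedC; apply/closed_lspecP; exists [set x].
apply/seteqP; split=> P /=.
  by move=> /contrapT Px _ ->.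
by move=> /(_ x erefl) Px; apply.
Qed.

Lemma lspec_open_sub (G : abLGroup) (U : set (lspec G)) (P Q : lspec G) :
  open U -> lspec_set P `<=` lspec_set Q -> U Q -> U P.
Proof.
rewrite -[U]setCK openC => /closed_lspecP[I IE] PQ UQ UP; apply: UQ.
by move: UP; rewrite IE /= => IP x /IP /PQ.
Qed.

(* In the proof, [z n] is [(u - n y)^+]: a point of [D] that avoids [y] and all
   the [z n] has [lideal_adjoin] as a proper specialisation. *)
Lemma lspec_obstruction (G : abLGroup) (X : topologicalType) (I : Type)
    (D : set I) (x : I -> X) (p q : X) :
  ~ countable D -> p <> q ->
  (forall U : set X, open U -> U p -> U q) ->
  (forall U : set X, open U -> U q -> finite_set [set i | D i /\ ~ U (x i)]) ->
  (forall i r, D i -> (forall U : set X, open U -> U r -> U (x i)) ->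
    r = x i) ->
  ~ homeomorphic X (lspec G).
Proof.
move=> ncD pq openp openq closedx [f [g [fc gc fK gK]]].
have opf V : open V -> open (f @^-1` V) by move/continuousP: fc; apply.
have opg U : open U -> open (g @^-1` U) by move/continuousP: gc; apply.
have qp : lspec_set (f q) `<=` lspec_set (f p).
  move=> z qz; apply: contrapT => pz.
  exact: (openp _ (opf _ (lspec_open_notin z)) pz).
have [y0 [py0 qy0]] : exists y, lspec_set (f p) y /\ ~ lspec_set (f q) y.
  apply: contrapT => noy; apply: pq; apply: (can_inj fK); apply/lspec_eq.
  apply/seteqP; split=> // z pz; apply: contrapT => qz; apply: noy.
  by exists z.
have [idp ppT _] := lspec_prime (f p).
have [u0 pu0] : exists u, ~ lspec_set (f p) u.
  apply: contrapT => nou; apply: ppT; apply/seteqP; split=> // z _.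
  by apply: contrapT => pz; apply: nou; exists z.
have [y [y_ge0 _ _ yP]] := lgroup_abs y0.
have [u [u_ge0 _ _ uP]] := lgroup_abs u0.
have ideal (P : lspec G) : lideal (lspec_set P) by have [] := lspec_prime P.
have py : lspec_set (f p) y by apply/yP.
have qy : ~ lspec_set (f q) y by move/yP => /(_ (ideal _)).
have pu : ~ lspec_set (f p) u by move/uP => /(_ (ideal _)).
have /choice[z zP] n := lo_join (lgroup_lattice G) (u - y *+ n) 0.
(* Since [u <= y *+ n + z n] and [f p] contains [y], it would contain [u] along with [z n]. *)
have pz n : ~ lspec_set (f p) (z n).
  have [uz z0 _] := zP n => pzn; apply: pu.
  apply: (lideal_convex (ideal _) (lideal0 (ideal _))
    (lidealD (ideal _) (lidealMn (ideal _) n py) pzn) u_ge0).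
  have := lgroup_translation (y *+ n) uz.
  by rewrite subrKC.
have [i [Di fiy fiz]] : exists i,
    [/\ D i, ~ lspec_set (f (x i)) y & forall n, ~ lspec_set (f (x i)) (z n)].
  apply: contrapT => noi; apply: ncD.
  have cy : countable [set i | D i /\ ~ ~ lspec_set (f (x i)) y].
    exact/finite_set_countable/(openq _ (opf _ (lspec_open_notin y)) qy).
  have cz : countable
      (\bigcup_n [set i | D i /\ ~ ~ lspec_set (f (x i)) (z n)]).
    apply: bigcup_countable => // n _; apply: finite_set_countable.
    have oz := opf _ (lspec_open_notin (z n)).
    exact: (openq _ oz (openp _ oz (pz n))).
  apply: sub_countable (countableU cy cz); apply: subset_card_le => i Di.
  apply: contrapT => /not_orP[niy niz]; apply: noi; exists i; split=> //.
    by move=> iy; apply: niy; split=> //; apply.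
  by move=> n iz; apply: niz; exists n => //; split=> //; apply.
pose Q := lideal_adjoin (lspec_set (f (x i))) y.
have primQ : prime_lideal Q.
  apply: (lideal_adjoin_prime (lspec_prime (f (x i))) y_ge0 (u := u)).
  (* If [u <= y *+ n + v] with [v] in the ideal, then [z n], the positive part of [u - y *+ n], is
     at most |v| and so lies in the ideal too. *)
  move=> n v iv uv.
  have [a [a0 va _ aP]] := lgroup_abs v.
  have [uz z0 zm] := zP n; apply: (fiz n).
  have ia : lspec_set (f (x i)) a by apply/aP.
  apply: (lideal_convex (ideal _) (lideal0 (ideal _)) ia z0).
  apply: zm => //; apply: lo_trans va; first exact: lgroup_lattice.
  have := lgroup_translation (- (y *+ n)) uv.
  by rewrite addKr addrC.
have /(congr1 f) : g (LSpec primQ) = x i.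
  apply: closedx => // U oU UQ; rewrite -[x i]fK.
  apply: (lspec_open_sub (opg _ oU) _ UQ) => v /=.
  exact: (sub_lideal_adjoin y (lspec_prime (f (x i)))).
rewrite gK => QE; apply: fiy; rewrite -QE /=.
exact: mem_lideal_adjoin (lspec_prime _) y_ge0.
Qed.

(** * The real spectrum of the ring of almost constant functions *)

Lemma rspec_eq (R : comNzRingType) (P Q : rspec R) :
  rspec_set P = rspec_set Q -> P = Q.
Proof.
case: P Q => [P hP] [Q hQ] /= PQ; move: hP; rewrite PQ => hP.
by congr RSpec; exact: Prop_irrelevance.
Qed.

Lemma rspec_open_notin (R : comNzRingType) (a : R) :
  open [set P : rspec R | ~ rspec_set P a].
Proof.
exists [set [set P : rspec R | ~ rspec_set P a]]; last by rewrite bigcup_set1.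
move=> _ ->; apply: finI_from1; by exists a.
Qed.

(** Filters are closed under finite intersections and supersets, so subbasic sets suffice. A
    principal filter yields specialisation, a cofinite one convergence. *)
Lemma rspec_open_filter (R : comNzRingType) (F : set_system (rspec R))
    (P : rspec R) : Filter F ->
  (forall a, ~ rspec_set P a -> F [set Q : rspec R | ~ rspec_set Q a]) ->
  forall U, open U -> U P -> F U.
Proof.
move=> FF FP _ [D sD <-] [B DB BP].
have [X sX XB] := sD _ DB.
apply: filterS (_ : F B); first by move=> Q BQ; exists B.
rewrite -XB; apply: filter_bigI => V XV.
have /set_mem[a _ VE] := sX _ XV; rewrite -VE; apply: FP.
by move: BP; rewrite -XB => /(_ _ XV); rewrite -VE.
Qed.

Lemma prime_coneP (R : comNzRingType) (P : set R) :
  (forall x y, P x -> P y -> P (x + y)) ->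
  (forall x y, P x -> P y -> P (x * y)) ->
  (forall x, P (x ^+ 2)) -> (forall x, P x \/ P (- x)) -> ~ P (-1) ->
  (forall x y, P (x * y) -> P (- (x * y)) ->
    (P x /\ P (- x)) \/ (P y /\ P (- y))) ->
  prime_cone P.
Proof.
move=> PD PM Psq Ptot PN1 Pprime.
have P0 : P 0 by have := Psq 0; rewrite expr0n.
have P1 : P 1 by have := Psq 1; rewrite expr1n.
split=> //; first split=> //.
  split; split; rewrite ?inE // => x y /set_mem Px /set_mem Py; apply/mem_set.
    exact: PD.
  exact: PM.
split; last first.
  by move=> x y /set_mem[] /Pprime{}Pprime /Pprime[?|?]; apply/orP;
    [left|right]; apply/mem_set.
split; first by apply/mem_set; rewrite /= oppr0.
  by apply/negP => /set_mem[].
move=> a x y /set_mem[Px PNx] /set_mem[Py PNy]; apply/mem_set => /=.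
(* Totality allows the multiplier [a] to be taken in [P] up to sign. *)
have [Pax PNax] : P (a * x) /\ P (- (a * x)).
  have [Pa|Pa] := Ptot a; first by rewrite -mulrN; split; apply: PM.
  by rewrite -mulNr -[a * x]mulrNN; split; apply: PM.
by rewrite opprD; split; apply: PD.
Qed.

(** * Infinitesimals of a real closed field *)

Section Infinitesimals.
Variable K : rcfType.
Implicit Types x y : K.

Definition infinitesimal x : Prop := forall n : nat, `|x| * n%:R <= 1.

Lemma infinitesimal_le x y : `|x| <= `|y| -> infinitesimal y -> infinitesimal x.
Proof. by move=> xy iy n; apply: le_trans (iy n); rewrite ler_wpM2r. Qed.

Lemma infinitesimal0 : infinitesimal 0.
Proof. by move=> n; rewrite normr0 mul0r ler01. Qed.

Lemma infinitesimalD x y :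
  infinitesimal x -> infinitesimal y -> infinitesimal (x + y).
Proof.
(* Testing at [2 * n] bounds each summand by one half. *)
move=> ix iy n; have := ix (2 * n)%N; have := iy (2 * n)%N.
have : `|x + y| * n%:R <= `|x| * n%:R + `|y| * n%:R.
  by rewrite -mulrDl ler_wpM2r// ler_normD.
by rewrite natrM !mulrA ![_ * 2]mulrC -!mulrA; lra.
Qed.

Lemma infinitesimal_nonneg_add x y : 0 <= x -> infinitesimal y ->
  0 <= x + y \/ infinitesimal (x + y).
Proof.
move=> x0 iy; have [?|xy0] := leP 0 (x + y); [by left|right].
apply: infinitesimal_le iy; rewrite ltr0_norm //.
by have := ler_norm (- y); rewrite normrN; lra.
Qed.

Lemma infinitesimalM x y :
  bounded_elt x -> infinitesimal y -> infinitesimal (x * y).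
Proof.
move=> [m xm] iy n; apply: le_trans (iy (m * n)%N).
by rewrite normrM natrM mulrA ler_wpM2r// [leLHS]mulrC ler_wpM2l.
Qed.

Lemma infinitesimal_prime x y :
  infinitesimal (x * y) -> infinitesimal x \/ infinitesimal y.
Proof.
move=> ixy; have [ix|/existsNP[n /negP]] := pselect (infinitesimal x).
  by left.
rewrite -ltNge => xn; right=> m; apply: le_trans (ixy (n * m)%N).
rewrite normrM natrM mulrACA -[leLHS]mul1r ler_wpM2r ?mulr_ge0//.
exact: ltW.
Qed.

End Infinitesimals.

Section AlmostConstantSpectrum.
Variables (W : pointedType) (K : rcfType).
Local Notation A := (acring W K).
Local Notation ev := (@acring_ev W K).

Lemma point_cone w : prime_cone [set f : A | 0 <= ev w f].
Proof.
apply: prime_coneP => [x y|x y|x|x||x y] /=.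
- by rewrite rmorphD; exact: addr_ge0.
- by rewrite rmorphM; exact: mulr_ge0.
- by rewrite rmorphXn sqr_ge0.
- by rewrite rmorphN oppr_ge0; apply/orP; exact: le_total.
- by rewrite rmorphN rmorph1 oppr_ge0 ler10.
- rewrite !rmorphN rmorphM !oppr_ge0 => xy0 xy1.
  have /eqP : ev w x * ev w y = 0 by apply/eqP; rewrite eq_le xy0 xy1.
  have e0 z : ev w z = 0 -> 0 <= ev w z /\ ev w z <= 0 by move=> ->.
  by rewrite mulf_eq0 => /orP[]/eqP/e0; [left|right].
Qed.

(** This is the pull-back, along the limit value, of the order on the bounded elements of [K] modulo
    infinitesimals. *)
Definition near_nonneg : set A :=
  [set f | 0 <= ev point f \/ infinitesimal (ev point f)].

Lemma near_nonnegN f :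
  near_nonneg f /\ near_nonneg (- f) <-> infinitesimal (ev point f).
Proof.
rewrite /near_nonneg /= rmorphN oppr_ge0; split=> [|i].
  case=> [[f0|//] [f1|/infinitesimal_le]]; last by apply; rewrite normrN.
  have -> : ev point f = 0 by apply/eqP; rewrite eq_le f0 f1.
  exact: infinitesimal0.
by split; right => //; apply: infinitesimal_le i; rewrite normrN.
Qed.

(** Closure under products rests on the boundedness of limit values, primality of the support on
    [infinitesimal_prime]. *)
Lemma near_nonneg_cone : prime_cone near_nonneg.
Proof.
apply: prime_coneP => [x y|x y|x|x||x y].
- rewrite /near_nonneg /= rmorphD => -[x0|ix] [y0|iy].
  + by left; exact: addr_ge0.
  + exact: infinitesimal_nonneg_add.
  + by rewrite addrC; exact: infinitesimal_nonneg_add.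
  + by right; apply: infinitesimalD.
- rewrite /near_nonneg /= rmorphM => -[x0|ix] [y0|iy].
  + by left; exact: mulr_ge0.
  + by right; apply: infinitesimalM iy; exact: acring_bounded.
  + by right; rewrite mulrC; apply: infinitesimalM ix; exact: acring_bounded.
  + by right; apply: infinitesimalM iy; exact: acring_bounded.
- by left; rewrite rmorphXn sqr_ge0.
- have [x0|x0] := leP 0 (ev point x); first by left; left.
  by right; left; rewrite rmorphN oppr_ge0 ltW.
- rewrite /near_nonneg /= rmorphN rmorph1 oppr_ge0 ler10 => -[//|/(_ 2%N)].
  by rewrite normrN normr1 mul1r lern1.
- move=> p1 p2; rewrite !near_nonnegN; apply: infinitesimal_prime.
  by rewrite -rmorphM; apply/near_nonnegN.
Qed.

Definition point_spec w : rspec A := RSpec (point_cone w).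
Definition near_nonneg_spec : rspec A := RSpec near_nonneg_cone.

Lemma near_nonneg_specialises (U : set (rspec A)) :
  open U -> U near_nonneg_spec -> U (point_spec point).
Proof.
move=> oU Up.
pose F := principal_filter (point_spec point).
apply: (@rspec_open_filter _ F near_nonneg_spec _ _ U) => // a na.
by apply/principal_filterP => /= a0; apply: na; left.
Qed.

(** The sets containing all but finitely many [point_spec w] form a filter, and a function negative
    at [point] is negative outside its exceptional set. *)
Lemma point_spec_limit (U : set (rspec A)) : open U -> U (point_spec point) ->
  finite_set [set w | ~ U (point_spec w)].
Proof.
move=> oU Uq; pose F : set_system (rspec A) :=
  [set V | finite_set [set w | ~ V (point_spec w)]].
have FF : Filter F.
  split=> /= [|V V' fV fV'|V V' VV'].
  - by rewrite /F /= (_ : [set _ | _] = set0)//; apply/seteqP; split=> w //=; apply.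
  - apply: (@sub_finite_set _ _ ([set w | ~ V (point_spec w)] `|`
                                 [set w | ~ V' (point_spec w)])).
      move=> w /=; have [?|?] := pselect (V (point_spec w)); last by left.
      by right=> ?; tauto.
    by rewrite finite_setU.
  - by apply: sub_finite_set => w /= nV' /VV'.
apply: (@rspec_open_filter _ F (point_spec point) FF _ U) => //= a na.
apply: sub_finite_set (acring_finite a) => w.
apply: contra_notP => /contrapT aw.
by move: na; rewrite [X in 0 <= X](esym aw).
Qed.

(** [r] contains the cone at [w]. If some [f] in [r] were negative at [w], a spike [g], nonnegative
    at [w], would give [g * f = - e] with [e] the indicator of [w]; then [e] and [1 - e], which
    vanishes at [w], would both lie in the support of [r], and so would 1. *)
Lemma point_spec_closed w (r : rspec A) : w <> point ->
  (forall U : set (rspec A), open U -> U r -> U (point_spec w)) ->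
  r = point_spec w.
Proof.
move=> /eqP wpt rU; apply: rspec_eq; apply/seteqP.
have sub : [set f : A | 0 <= ev w f] `<=` rspec_set r.
  by move=> a a0; apply: contrapT => /(rU _ (rspec_open_notin a)); apply.
split=> // f rf; have [//|fw] := leP 0 (ev w f); exfalso.
have [[[_ [_ rM]] _] _ [[_ /negP r1 rI] _]] := rspec_prime r.
pose e := AcRing (spikeP w (1 : K)).
pose g := AcRing (spikeP w (- (ev w f)^-1)).
have evs v x : ev v (AcRing (spikeP w x)) = if v == w then x else 0.
  by rewrite /acring_ev /= /spike wpt andbT.
have eE : ev w e = 1 by rewrite evs eqxx.
have gf : g * f = - e.
  apply: (ivt_inj (@acring_ivt W K)) => v.
  transitivity (ev v g * ev v f); first exact: rmorphM.
  transitivity (- ev v e); last by rewrite rmorphN.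
  rewrite !evs; case: eqVneq => [->|_]; last by rewrite mul0r oppr0.
  by rewrite mulNr mulVf ?lt_eqF.
have rNe : rspec_set r (- e).
  rewrite -gf; apply/set_mem/rM; apply/mem_set => //; apply: sub.
  by rewrite /= evs eqxx oppr_ge0 invr_le0 ltW.
apply: r1; rewrite -(subrKC e 1) -[e in e + _]mul1r; apply: rI; apply/mem_set.
  by split=> //; apply: sub; rewrite /= eE.
have e0 : ev w (1 - e) = 0.
  by transitivity (1 - ev w e); [rewrite rmorphB rmorph1|rewrite eE subrr].
have Ne0 : ev w (- (1 - e)) = 0.
  by transitivity (- ev w (1 - e)); [rewrite rmorphN|rewrite e0 oppr0].
by split; apply: sub; rewrite /= ?e0 ?Ne0.
Qed.

Lemma acring_not_lspec (t : K) (G : abLGroup) : ~ countable [set: W] ->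
  t != 0 -> infinitesimal t -> ~ homeomorphic (rspec A) (lspec G).
Proof.
move=> ncW t0 it; apply: (@lspec_obstruction G (rspec A) W [set~ point]
  point_spec near_nonneg_spec (point_spec point)).
- move=> cW; apply: ncW; rewrite -(setUv [set point]).
  by apply: countableU => //; exact: countable1.
(* The constant function [- |t|] tells the two cones apart, being infinitesimal but negative at
   [point]. *)
- have h : almost_const (fun _ : W => - `|t|).
    apply/asboolP; split; last first.
      by rewrite (_ : exceptional _ = set0)//; apply/seteqP; split=> w //; case.
    by exists 1%N; have := it 1%N; rewrite normrN normr_id mulr1.
  move=> /(congr1 (fun P => rspec_set P (AcRing h))) /= E.
  suff : 0 <= - `|t| by rewrite oppr_ge0 normr_le0 (negPf t0).
  rewrite -[_ <= _]/(0 <= ev point (AcRing h)).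
  have : near_nonneg (AcRing h) by right=> n; rewrite normrN normr_id.
  by rewrite E.
- exact: near_nonneg_specialises.
- move=> U oU Uq; apply: sub_finite_set (point_spec_limit oU Uq) => w /=.
  by case.
- by move=> w r wpt; apply: point_spec_closed.
Qed.

End AlmostConstantSpectrum.

Theorem theorem5p4 :
  exists A : comNzRingType,
    [/\ real_closed_ring A,
        has_card_aleph1 A &
        forall G : abLGroup, ~ homeomorphic (rspec A) (lspec G)].
Proof.
have [K [cK [t [t0 tP]]]] := countable_nonarchimedean_rcf.
have [W0 [le [wo ncW cle]]] := exists_aleph1.
have [w0] : exists w : W0, True.
  apply: contrapT => now; apply: ncW; rewrite (_ : [set: W0] = set0) //.
  by apply/seteqP; split=> // w _; case: now; exists w.
pose W : pointedType := HB.pack W0 (isPointed.Build W0 w0).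
exists (acring W K); split.
- exact: ivt_real_closed_ring (@acring_ivt W K).
- exact: (@acring_aleph1 W K le).
- move=> G; apply: (@acring_not_lspec W K t) => //; first by rewrite gt_eqF.
  by move=> n; rewrite gtr0_norm // mulr_natr.
Qed.
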